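(* ($\mathsf{CZF}^-$) The double complement of $2$ is the powerclass of $1$, i.e. $\{z : \neg\neg(z\in 2)\} = \mathcal{P}(1)$ (as classes). Moreover, the double complement of $\{1\}$ is $\{z : \neg\neg(z\in\{1\})\} = \{x\subseteq 1 \mid \neg\neg(x=1)\}$.
   Context: The logic is intuitionistic. $\mathsf{CZF}^-$ is the intuitionistic theory in the language of set theory with axioms Extensionality, Pairing, Union, Infinity, the $\in$-Induction scheme, $\Delta_0$-Separation, and Strong Collection (if $\forall x\in a\,\exists y\,\phi(x,y)$ then there is a set $b$ with $\forall x\in a\,\exists y\in b\,\phi(x,y)$ and $\forall y\in b\,\exists x\in a\,\phi(x,y)$). Here $0=\varnothing$, $1=\{0\}$, $2=\{0,1\}$. The double complement of a class $x$ is the class $x^{\neg\neg}=\{z : \neg\neg(z\in x)\}$. The powerclass $\mathcal{P}(a)=\{b\mid b\subseteq a\}$ need not be a set. *)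

(* Defs.v *)
From Stdlib Require Import List.
Import ListNotations.

(** Variables are de Bruijn indices: under a quantifier, index 0 is the bound
    variable and [S n] is the variable called [n] outside.  The language has no
    function symbols, so terms are variables and substitution is renaming. *)

Inductive form : Type :=
| Mem : nat -> nat -> form
| Eq  : nat -> nat -> form
| Bot : form
| And : form -> form -> form
| Or  : form -> form -> form
| Imp : form -> form -> form
| All : form -> form
| Ex  : form -> form.

Declare Scope form_scope.
Delimit Scope form_scope with form.
Bind Scope form_scope with form.

Notation "x '∈' y" := (Mem x y) (at level 70) : form_scope.
Notation "x '≈' y" := (Eq x y) (at level 70) : form_scope.
Notation "⊥" := Bot : form_scope.
Notation "A ∧ B" := (And A B) (at level 80, right associativity) : form_scope.
Notation "A ∨ B" := (Or A B) (at level 85, right associativity) : form_scope.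
Notation "A ⇒ B" := (Imp A B) (at level 90, right associativity) : form_scope.
Notation "¬ A" := (Imp A Bot) (at level 75, right associativity) : form_scope.
Notation "A ⇔ B" := (And (Imp A B) (Imp B A)) (at level 95, no associativity)
  : form_scope.
Notation "∀' A" := (All A) (at level 99, right associativity) : form_scope.
Notation "∃' A" := (Ex A) (at level 99, right associativity) : form_scope.
Open Scope form_scope.

Definition scons (i : nat) (f : nat -> nat) (n : nat) : nat :=
  match n with 0 => i | S m => f m end.

Definition up (f : nat -> nat) : nat -> nat := scons 0 (fun n => S (f n)).

Fixpoint ren (f : nat -> nat) (A : form) : form :=
  match A with
  | Mem x y => Mem (f x) (f y)
  | Eq x y => Eq (f x) (f y)
  | Bot => Bot
  | And B C => And (ren f B) (ren f C)
  | Or B C => Or (ren f B) (ren f C)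
  | Imp B C => Imp (ren f B) (ren f C)
  | All B => All (ren (up f) B)
  | Ex B => Ex (ren (up f) B)
  end.

Definition shift (A : form) : form := ren S A.

Definition inst (t : nat) (A : form) : form := ren (scons t (fun n => n)) A.

(** Intuitionistic natural deduction with equality:
    [prv T G A]: [A] is derivable in the theory [T] from the hypotheses [G].
    Free variables of an axiom in [T] are read as universally quantified: the
    eigenvariable conditions of [prv_AllI] and [prv_ExE] concern [G] only. *)

Inductive prv (T : form -> Prop) : list form -> form -> Prop :=
| prv_Hyp  G A : In A G -> prv T G A
| prv_Ax   G A : T A -> prv T G A
| prv_BotE G A : prv T G Bot -> prv T G A
| prv_ImpI G A B : prv T (A :: G) B -> prv T G (Imp A B)
| prv_ImpE G A B : prv T G (Imp A B) -> prv T G A -> prv T G B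
| prv_AndI G A B : prv T G A -> prv T G B -> prv T G (And A B)
| prv_AndE1 G A B : prv T G (And A B) -> prv T G A
| prv_AndE2 G A B : prv T G (And A B) -> prv T G B
| prv_OrI1 G A B : prv T G A -> prv T G (Or A B)
| prv_OrI2 G A B : prv T G B -> prv T G (Or A B)
| prv_OrE  G A B C :
    prv T G (Or A B) -> prv T (A :: G) C -> prv T (B :: G) C -> prv T G C
| prv_AllI G A : prv T (map shift G) A -> prv T G (All A)
| prv_AllE G A t : prv T G (All A) -> prv T G (inst t A)
| prv_ExI  G A t : prv T G (inst t A) -> prv T G (Ex A)
| prv_ExE  G A B :
    prv T G (Ex A) -> prv T (A :: map shift G) (shift B) -> prv T G B
| prv_EqRefl  G t : prv T G (Eq t t)
| prv_EqSubst G A s t :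
    prv T G (Eq s t) -> prv T G (inst s A) -> prv T G (inst t A).

(** A formula [A] also denotes the class [{z | A}]: index 0 is [z], and the
    parameter called [n] outside is [S n] in [A]. *)

Definition class_eq (A B : form) : form := ∀' (A ⇔ B).

Definition ext (a : nat) : form := 0 ∈ S a.
Definition empty_class : form := ⊥.
Definition sing (a : nat) : form := 0 ≈ S a.
Definition upair (a b : nat) : form := (0 ≈ S a) ∨ (0 ≈ S b).
Definition union_class (a : nat) : form := ∃' ((0 ∈ S (S a)) ∧ (1 ∈ 0)).
Definition succ_class (a : nat) : form := (0 ∈ S a) ∨ (0 ≈ S a).
Definition inter (A B : form) : form := A ∧ B.

Definition subset (a b : nat) : form := ∀' (0 ∈ S a ⇒ 0 ∈ S b).
Definition powerclass (a : nat) : form := subset 0 (S a).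

Definition double_complement (A : form) : form := ¬ ¬ A.

Definition is_class (a : nat) (A : form) : form := class_eq (ext a) A.

Inductive Delta0 : form -> Prop :=
| Delta0_Mem x y : Delta0 (x ∈ y)
| Delta0_Eq x y : Delta0 (x ≈ y)
| Delta0_Bot : Delta0 ⊥
| Delta0_And A B : Delta0 A -> Delta0 B -> Delta0 (A ∧ B)
| Delta0_Or A B : Delta0 A -> Delta0 B -> Delta0 (A ∨ B)
| Delta0_Imp A B : Delta0 A -> Delta0 B -> Delta0 (A ⇒ B)
| Delta0_All a A : Delta0 A -> Delta0 (∀' (0 ∈ S a ⇒ A))
| Delta0_Ex a A : Delta0 A -> Delta0 (∃' ((0 ∈ S a) ∧ A)).

Definition ax_extensionality : form :=
  ∀' ∀' (class_eq (ext 1) (ext 0) ⇒ 1 ≈ 0).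

Definition ax_pairing : form := ∀' ∀' ∃' is_class 0 (upair 2 1).

Definition ax_union : form := ∀' ∃' is_class 0 (union_class 1).

(** [∃w ∀x (x ∈ w ↔ x = ∅ ∨ ∃y∈w x = y ∪ {y})]. *)
Definition ax_infinity : form :=
  ∃' is_class 0
       (is_class 0 empty_class ∨ ∃' ((0 ∈ 2) ∧ is_class 1 (succ_class 0))).

(** In [A], index 0 is the variable of the induction. *)
Definition ax_induction (A : form) : form :=
  (∀' ((∀' (0 ∈ 1 ⇒ ren (up S) A)) ⇒ A)) ⇒ ∀' A.

(** In [A], index 0 is the element and index 1 is the set to be separated
    from; the renaming keeps the new set from occurring in [A]. *)
Definition ax_separation (A : form) : form :=
  ∀' ∃' is_class 0 (inter (ext 1) (ren (up S) A)).

(** In [A = φ(x,y)], index 0 is [y], 1 is [x] and 2 is [a]; the renamings keep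
    [b] from occurring in [φ], and the last one also exchanges [x] and [y]. *)
Definition ax_strong_collection (A : form) : form :=
  ∀' ((∀' (0 ∈ 1 ⇒ ∃' A)) ⇒
      ∃' ((∀' (0 ∈ 2 ⇒ ∃' ((0 ∈ 2) ∧ ren (up (up S)) A))) ∧
          (∀' (0 ∈ 1 ⇒ ∃' ((0 ∈ 3) ∧
             ren (scons 1 (scons 0 (fun n => S (S (S n))))) A))))).

Inductive CZFm : form -> Prop :=
| CZFm_extensionality : CZFm ax_extensionality
| CZFm_pairing : CZFm ax_pairing
| CZFm_union : CZFm ax_union
| CZFm_infinity : CZFm ax_infinity
| CZFm_induction A : CZFm (ax_induction A)
| CZFm_separation A : Delta0 A -> CZFm (ax_separation A)
| CZFm_strong_collection A : CZFm (ax_strong_collection A).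

(** The language has no constants, so 0, 1, 2 and {1} are variables pinned
    down by their defining properties. *)
Definition numerals (zero one two sone : nat) : form :=
  is_class zero empty_class ∧ is_class one (sing zero) ∧
  is_class two (upair zero one) ∧ is_class sone (sing one).

(* Main.v *)
Require Import Defs.
From Stdlib Require Import List.
Import ListNotations.

(** Membership in [1] is stable under double negation: [x ∈ 1] says that [x]
    is [0], hence, by extensionality, that [x] has no elements, which is a
    negative statement ([mem_one_stable]).  So [z ⊆ 1] is stable too
    ([subset_one_stable]).  Since every element of [2], and of [{1}], is a
    subset of [1], this yields the inclusions into [P(1)] of both double
    complements.

    For the inclusion of [P(1)] in the double complement of [2], let [z ⊆ 1] and
    suppose [z ∉ 2].  An element of [z] could only be [0], so if [z] had one, [z]
    would be [1], an element of [2] ([inhabited_subset_one]).  Thus [z] has no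
    elements and is [0], again an element of [2]: a contradiction.  For [{1}], the
    formulas [z ∈ {1}] and [z = 1] are equivalent, and so are their double
    negations.

    Facts about particular sets are assumed below in the form [In A G] and not
    [prv T G A]: by [in_map] the former passes to the context [map shift G] of
    an eigenvariable rule, and the shift of a formula such as
    [is_class a (sing b)] computes to [is_class (S a) (sing (S b))]. *)

(** * Derived rules of intuitionistic logic with equality *)

Ltac in_ctx :=
  first
    [ assumption
    | exact (or_introl eq_refl)
    | match goal with
      | H : In ?A ?G |- _ => exact (in_map shift G A H)
      end
    | apply in_cons; in_ctx ].

Ltac hyp := apply prv_Hyp; in_ctx.

Lemma prv_cut T G A B : prv T G A -> prv T (A :: G) B -> prv T G B.
Proof. intros HA HB. exact (prv_ImpE _ _ _ _ (prv_ImpI _ _ _ _ HB) HA). Qed.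

Lemma prv_AllE2 T G A x y :
  prv T G (∀' ∀' A) ->
  prv T G (inst y (ren (up (scons x (fun n => n))) A)).
Proof. intro H. exact (prv_AllE _ _ _ y (prv_AllE _ _ _ x H)). Qed.

Lemma prv_eq_sym T G x y : prv T G (x ≈ y) -> prv T G (y ≈ x).
Proof.
  intro H. exact (prv_EqSubst T G (0 ≈ S x) x y H (prv_EqRefl T G x)).
Qed.

Lemma prv_eq_trans T G x y z :
  prv T G (x ≈ y) -> prv T G (y ≈ z) -> prv T G (x ≈ z).
Proof. intros H K. exact (prv_EqSubst T G (S x ≈ 0) y z K H). Qed.

Lemma prv_mem_eq_l T G x y a :
  prv T G (x ≈ y) -> prv T G (x ∈ a) -> prv T G (y ∈ a).
Proof. exact (prv_EqSubst T G (0 ∈ S a) x y). Qed.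

Lemma prv_mem_eq_r T G u x y :
  prv T G (x ≈ y) -> prv T G (u ∈ x) -> prv T G (u ∈ y).
Proof. exact (prv_EqSubst T G (S u ∈ 0) x y). Qed.

(** The premise keeps the hypotheses introduced on the way, so that no weakening
    of contexts has to be proved. *)
Lemma prv_dneg_mono T G A B :
  prv T (A :: (¬ B) :: (¬ ¬ A) :: G) B -> prv T G (¬ ¬ A ⇒ ¬ ¬ B).
Proof.
  intro H. apply prv_ImpI, prv_ImpI.
  apply prv_ImpE with (¬ A); [hyp|].
  apply prv_ImpI. apply prv_ImpE with B; [hyp | exact H].
Qed.

(** * Sets given by a defining class *)

Lemma class_elim T G a A x :
  prv T G (is_class a A) -> prv T G (x ∈ a) -> prv T G (inst x A).
Proof.
  intros HA Hx. refine (prv_ImpE _ _ _ _ _ Hx).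
  exact (prv_AndE1 _ _ _ _ (prv_AllE _ _ _ x HA)).
Qed.

Lemma class_intro T G a A x :
  prv T G (is_class a A) -> prv T G (inst x A) -> prv T G (x ∈ a).
Proof.
  intros HA Hx. refine (prv_ImpE _ _ _ _ _ Hx).
  exact (prv_AndE2 _ _ _ _ (prv_AllE _ _ _ x HA)).
Qed.

Lemma subset_elim T G a b x :
  prv T G (subset a b) -> prv T G (x ∈ a) -> prv T G (x ∈ b).
Proof.
  intros Hs Hx. exact (prv_ImpE _ _ _ _ (prv_AllE _ _ _ x Hs) Hx).
Qed.

Lemma prv_extensionality G x y :
  prv CZFm ((0 ∈ S x) :: map shift G) (0 ∈ S y) ->
  prv CZFm ((0 ∈ S y) :: map shift G) (0 ∈ S x) ->
  prv CZFm G (x ≈ y).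
Proof.
  intros H K. apply prv_ImpE with (class_eq (ext x) (ext y)).
  - exact (prv_AllE2 _ _ _ x y (prv_Ax _ G _ CZFm_extensionality)).
  - apply prv_AllI, prv_AndI; apply prv_ImpI; assumption.
Qed.

(** * Existence of the numerals *)

Lemma exists_empty G : prv CZFm G (∃' is_class 0 empty_class).
Proof.
  (* Separation needs a set to start from; any variable denotes one. *)
  eapply prv_ExE.
  - exact (prv_AllE _ _ _ 0
             (prv_Ax _ G _ (CZFm_separation ⊥ Delta0_Bot))).
  - apply prv_ExI with 0. apply prv_AllI, prv_AndI; apply prv_ImpI.
    + eapply prv_AndE2.
      apply (class_elim _ _ 1 (inter (ext 2) ⊥) 0); hyp.
    + apply prv_BotE. hyp.
Qed.

Lemma exists_upair G a b :
  prv CZFm G (∃' is_class 0 (upair (S a) (S b))).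
Proof.
  exact (prv_AllE2 _ _ _ a b (prv_Ax _ G _ CZFm_pairing)).
Qed.

Lemma exists_sing G a : prv CZFm G (∃' is_class 0 (sing (S a))).
Proof.
  eapply prv_ExE; [exact (exists_upair G a a)|].
  apply prv_ExI with 0. apply prv_AllI, prv_AndI; apply prv_ImpI.
  - apply prv_OrE with (0 ≈ S (S a)) (0 ≈ S (S a)); [|hyp|hyp].
    apply (class_elim _ _ 1 (upair (S (S a)) (S (S a))) 0); hyp.
  - apply (class_intro _ _ 1 (upair (S (S a)) (S (S a))) 0); [hyp|].
    apply prv_OrI1. hyp.
Qed.

Lemma exists_numerals G : prv CZFm G (∃' ∃' ∃' ∃' numerals 3 2 1 0).
Proof.
  eapply prv_ExE; [apply exists_empty|].
  eapply prv_ExE; [apply (exists_sing _ 0)|].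
  eapply prv_ExE; [apply (exists_upair _ 1 0)|].
  eapply prv_ExE; [apply (exists_sing _ 1)|].
  apply prv_ExI with 3, prv_ExI with 2, prv_ExI with 1, prv_ExI with 0.
  repeat apply prv_AndI; hyp.
Qed.

(** * Subsets of 1 *)

Lemma mem_empty_absurd T G o u B :
  In (is_class o empty_class) G -> prv T G (u ∈ o) -> prv T G B.
Proof.
  intros Ho Hu. apply prv_BotE.
  apply (class_elim _ _ o empty_class u); [hyp | exact Hu].
Qed.

Lemma mem_sing_elim T G a s x :
  In (is_class s (sing a)) G -> prv T G (x ∈ s) -> prv T G (x ≈ a).
Proof. intro Hs. apply (class_elim _ _ s (sing a) x). hyp. Qed.

Lemma mem_sing_intro T G a s x :
  In (is_class s (sing a)) G -> prv T G (x ≈ a) -> prv T G (x ∈ s).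
Proof. intro Hs. apply (class_intro _ _ s (sing a) x). hyp. Qed.

(** Membership in [1 = {0}] amounts to having no elements, a negative
    condition. *)
Lemma mem_one_stable G o i x :
  In (is_class o empty_class) G -> In (is_class i (sing o)) G ->
  prv CZFm G (¬ ¬ (x ∈ i) ⇒ x ∈ i).
Proof.
  intros Ho Hi. apply prv_ImpI.
  apply mem_sing_intro with o; [in_ctx|].
  apply prv_extensionality; apply mem_empty_absurd with (S o) 0;
    try in_ctx; [|hyp].
  (* An element of [x] refutes [x ∈ 1], against the hypothesis. *)
  apply prv_BotE. apply prv_ImpE with (¬ (S x ∈ S i)); [hyp|].
  apply prv_ImpI. apply mem_empty_absurd with (S o) 0; [in_ctx|].
  apply prv_mem_eq_r with (S x); [|hyp].
  apply mem_sing_elim with (S i); [in_ctx | hyp].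
Qed.

Lemma subset_one_stable G o i z :
  In (is_class o empty_class) G -> In (is_class i (sing o)) G ->
  prv CZFm G (¬ ¬ subset z i ⇒ subset z i).
Proof.
  intros Ho Hi. apply prv_ImpI, prv_AllI, prv_ImpI.
  apply prv_ImpE with (¬ ¬ (0 ∈ S i)).
  - apply mem_one_stable with (S o); in_ctx.
  - apply prv_ImpE with (¬ ¬ subset (S z) (S i)); [|hyp].
    apply prv_dneg_mono. apply subset_elim with (S z); hyp.
Qed.

Lemma inhabited_subset_one G o i z u :
  In (is_class i (sing o)) G -> In (subset z i) G -> In (u ∈ z) G ->
  prv CZFm G (z ≈ i).
Proof.
  intros Hi Hz Hu. apply prv_extensionality.
  - apply subset_elim with (S z); hyp.
  - (* Both [u] and the new element are equal to [0]. *)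
    apply prv_mem_eq_l with (S u); [|hyp].
    apply prv_eq_trans with (S o).
    + apply mem_sing_elim with (S i); [in_ctx|].
      apply subset_elim with (S z); hyp.
    + apply prv_eq_sym. apply mem_sing_elim with (S i); [in_ctx | hyp].
Qed.

Lemma eq_subset T G x y : prv T G (x ≈ y ⇒ subset x y).
Proof.
  apply prv_ImpI, prv_AllI, prv_ImpI.
  apply prv_mem_eq_r with (S x); hyp.
Qed.

Lemma empty_subset T G o x y :
  In (is_class o empty_class) G -> prv T G (x ≈ o ⇒ subset x y).
Proof.
  intro Ho. apply prv_ImpI, prv_AllI, prv_ImpI.
  apply mem_empty_absurd with (S o) 0; [in_ctx|].
  apply prv_mem_eq_r with (S x); hyp.
Qed.

(** * The double complements of 2 and of the singleton of 1 *)

Lemma double_complement_two G o i t :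
  In (is_class o empty_class) G -> In (is_class i (sing o)) G ->
  In (is_class t (upair o i)) G ->
  prv CZFm G (class_eq (double_complement (ext t)) (powerclass i)).
Proof.
  intros Ho Hi Ht. apply prv_AllI, prv_AndI; apply prv_ImpI.
  - apply prv_ImpE with (¬ ¬ subset 0 (S i)).
    { apply subset_one_stable with (S o); in_ctx. }
    apply prv_ImpE with (¬ ¬ (0 ∈ S t)); [|hyp].
    apply prv_dneg_mono.
    apply prv_OrE with (0 ≈ S o) (0 ≈ S i).
    + apply (class_elim _ _ (S t) (upair (S o) (S i)) 0); hyp.
    + apply prv_ImpE with (0 ≈ S o); [|hyp]. apply empty_subset. in_ctx.
    + apply prv_ImpE with (0 ≈ S i); [|hyp]. apply eq_subset.
  - apply prv_ImpI. apply prv_ImpE with (0 ∈ S t); [hyp|].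
    (* If [z ⊆ 1] is not in [2], it is [0]: any element would make it [1]. *)
    apply (class_intro _ _ (S t) (upair (S o) (S i)) 0); [hyp|].
    apply prv_OrI1. apply prv_extensionality.
    + assert (Hi' := in_map shift _ _ (in_map shift _ _ Hi)).
      assert (Ht' := in_map shift _ _ (in_map shift _ _ Ht)).
      apply prv_BotE. apply prv_ImpE with (1 ∈ S (S t)); [hyp|].
      apply (class_intro _ _ (S (S t)) (upair (S (S o)) (S (S i))) 1); [hyp|].
      apply prv_OrI2.
      apply inhabited_subset_one with (S (S o)) 0; in_ctx.
    + assert (Ho' := in_map shift _ _ (in_map shift _ _ Ho)).
      apply mem_empty_absurd with (S (S o)) 0; [in_ctx | hyp].
Qed.

Lemma double_complement_sing_one G o i s :
  In (is_class o empty_class) G -> In (is_class i (sing o)) G ->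
  In (is_class s (sing i)) G ->
  prv CZFm G
    (class_eq (double_complement (ext s))
              (inter (powerclass i) (double_complement (sing i)))).
Proof.
  intros Ho Hi Hs. apply prv_AllI, prv_AndI; apply prv_ImpI.
  - apply prv_cut with (¬ ¬ (0 ≈ S i)).
    { apply prv_ImpE with (¬ ¬ (0 ∈ S s)); [|hyp].
      apply prv_dneg_mono. apply mem_sing_elim with (S s); [in_ctx | hyp]. }
    apply prv_AndI; [|hyp].
    apply prv_ImpE with (¬ ¬ subset 0 (S i)).
    { apply subset_one_stable with (S o); in_ctx. }
    apply prv_ImpE with (¬ ¬ (0 ≈ S i)); [|hyp].
    apply prv_dneg_mono.
    apply prv_ImpE with (0 ≈ S i); [apply eq_subset | hyp].
  - apply prv_ImpE with (¬ ¬ (0 ≈ S i)).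
    + apply prv_dneg_mono. apply mem_sing_intro with (S i); [in_ctx | hyp].
    + eapply prv_AndE2. hyp.
Qed.

Theorem theorem3p7 :
  let zero := 3 in let one := 2 in let two := 1 in let sone := 0 in
  prv CZFm [] (∃' ∃' ∃' ∃' numerals zero one two sone)
  /\
  prv CZFm []
    (∀' ∀' ∀' ∀'
      (numerals zero one two sone ⇒
        class_eq (double_complement (ext two)) (powerclass one)
        ∧
        class_eq (double_complement (ext sone))
                 (inter (powerclass one) (double_complement (sing one))))).
Proof.
  intros zero one two sone. split; [apply exists_numerals|].
  do 4 apply prv_AllI. apply prv_ImpI.
  set (N := numerals zero one two sone).
  assert (HN : forall G, In N G -> prv CZFm G N) by (intros; hyp).
  apply prv_cut with (is_class zero empty_class).
  { eapply prv_AndE1. apply HN. in_ctx. }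
  apply prv_cut with (is_class one (sing zero)).
  { eapply prv_AndE1, prv_AndE2. apply HN. in_ctx. }
  apply prv_cut with (is_class two (upair zero one)).
  { eapply prv_AndE1, prv_AndE2, prv_AndE2. apply HN. in_ctx. }
  apply prv_cut with (is_class sone (sing one)).
  { eapply prv_AndE2, prv_AndE2, prv_AndE2. apply HN. in_ctx. }
  apply prv_AndI.
  - apply double_complement_two with zero; in_ctx.
  - apply double_complement_sing_one with zero; in_ctx.
Qed.
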